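(* Let $(S,\mathcal{B})$ be a standard Borel space and let $X=(X_1,X_2,\ldots)$ be a sequence of $S$-valued random variables on a probability space $(\Omega,\mathcal{A},P)$. Let $\mathcal{F}_0=\{\emptyset,\Omega\}$, $\mathcal{F}_n=\sigma(X_1,\ldots,X_n)$ for $n\ge 1$, and let $(\mathcal{G}_n)_{n\ge 0}$ be a filtration on $(\Omega,\mathcal{A},P)$ with $\mathcal{G}_n\subset\mathcal{F}_n$ for each $n\ge 0$. Suppose that $$E\{f(X_k)\mid\mathcal{G}_n\}=E\{f(X_{n+1})\mid\mathcal{G}_n\}\quad\text{a.s. for all }k>n\ge 0\text{ and all }f\in M_b(S).$$ Let $\alpha_n(f)=E\{f(X_{n+1})\mid\mathcal{F}_n\}$ and $\beta_n(f)=E\{f(X_{n+1})\mid\mathcal{G}_n\}$ for $n\ge 0$ and $f\in M_b(S)$, and define $\mathcal{F}_\infty=\sigma(\bigcup_n\mathcal{F}_n)$ and $\mathcal{G}_\infty=\sigma(\bigcup_n\mathcal{G}_n)$. Consider the conditions: (a) for each $f\in M_b(S)$, $\alpha_n(f)$ converges in probability as $n\to\infty$; (b) $\lim_n E\{\alpha_n(f)^2\}=\lim_n E\{\beta_n(f)^2\}$ (both limits existing) for each $f\in M_b(S)$. Then (b) implies (a). Moreover, if $\mathcal{G}_\infty=\mathcal{F}_\infty$, then (a) implies (b).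
   Context: A standard Borel space $(S,\mathcal{B})$ here means that $S$ is a Borel subset of some Polish space and $\mathcal{B}$ is the Borel $\sigma$-field on $S$. $M_b(S)$ is the set of real bounded $\mathcal{B}$-measurable functions on $S$. $\alpha_n(f)$ and $\beta_n(f)$ are the integrals of $f$ with respect to the (regular) conditional distributions $\alpha_n(\cdot)=P(X_{n+1}\in\cdot\mid\mathcal{F}_n)$ and $\beta_n(\cdot)=P(X_{n+1}\in\cdot\mid\mathcal{G}_n)$, so they are defined up to almost sure equality by the formulas in the claim. *)

(* Defs.v *)
From HB Require Import structures.
From mathcomp Require Import all_boot all_order all_algebra.
From mathcomp Require Import all_classical all_reals all_analysis.
From mathcomp Require Import measurable_realfun.

Set Implicit Arguments.
Unset Strict Implicit.
Unset Printing Implicit Defensive.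

Import Order.TTheory GRing.Theory Num.Theory.
Import numFieldNormedType.Exports.

Local Open Scope classical_set_scope.
Local Open Scope ring_scope.

(* On a Hausdorff space, a complete pseudometric is a complete metric. *)
Definition polish (R : realType) (T : completePseudoMetricType R) : Prop :=
  hausdorff_space T /\ exists2 D : set T, countable D & dense D.

Definition borel (T : topologicalType) : set (set T) := <<s @open T>>.

(* [i] plays the role of the inclusion of the Borel subset [S] in the Polish
   space [T]; the last conjunct says that the sigma-field of [S] is the trace
   of the Borel sigma-field of [T]. *)
Definition standard_borel (R : realType) (d : measure_display)
    (S : measurableType d) : Prop :=
  exists (T : completePseudoMetricType R) (i : S -> T),
    [/\ polish T, injective i, borel (range i) &
        @measurable _ S = preimage_set_system setT i (@borel T)].

Definition bounded_measurable (R : realType) (d : measure_display)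
    (S : measurableType d) (f : S -> R) : Prop :=
  measurable_fun setT f /\ exists M : R, forall x, `|f x| <= M.

Section conditional_expectation.
Context (R : realType) (d : measure_display) (Omega : measurableType d).
Variable P : probability Omega R.
Local Open Scope ereal_scope.

(* When [G] is a sigma-field, the first conjunct is [G]-measurability of [Z],
   since the measurable sets of [g_sigma_algebraType G] are then the elements
   of [G]. *)
Definition is_cond_exp (G : set (set Omega)) (Y Z : Omega -> R) : Prop :=
  [/\ measurable_fun (setT : set (g_sigma_algebraType G)) Z,
      P.-integrable setT (EFin \o Z) &
      forall A, G A -> \int[P]_(w in A) (Z w)%:E = \int[P]_(w in A) (Y w)%:E].

(* A chosen version of E{Y | G}; one exists by [cond_expP]. *)
Definition cond_exp (G : set (set Omega)) (Y : Omega -> R) : Omega -> R :=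
  xget (cst 0%R) [set Z | is_cond_exp G Y Z].

Lemma cond_expP (G : set (set Omega)) (Y : Omega -> R) :
  sigma_algebra setT G -> G `<=` measurable ->
  P.-integrable setT (EFin \o Y) -> is_cond_exp G Y (cond_exp G Y).
Proof.
move=> sG Gm intY; have mY := measurable_int _ intY.
have GE : @measurable _ (g_sigma_algebraType G) = G.
  exact: measurable_g_measurableTypeE.
pose j : Omega -> g_sigma_algebraType G := id.
have mj : measurable_fun setT j by move=> _ B; rewrite GE setTI => /Gm.
pose j' : {mfun Omega >-> g_sigma_algebraType G} :=
  HB.pack j (isMeasurableFun.Build _ _ _ _ _ mj).
pose mu : probability (g_sigma_algebraType G) R := distribution P j'.
pose nu0 : {charge set Omega -> \bar R} := induced_charge intY.
have nu0P : nu0 `<< P.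
  apply/null_content_dominatesP => A mA PA0; rewrite /nu0/= /induced_charge.
  apply: null_set_integral => //.
  exact: measurable_funS measurableT (@subsetT _ A) mY.
pose pf_nu0 : {charge set (g_sigma_algebraType G) -> \bar R} :=
  pushforward nu0 j.
pose nu := pf_nu0 mj.
have numu : nu `<< mu by exact: dominates_pushforward.
have [f [ffin intf fE]] : exists f : g_sigma_algebraType G -> \bar R,
    [/\ forall x, f x \is a fin_num, mu.-integrable setT f &
      forall A, measurable A -> nu A = \int[mu]_(x in A) f x].
  exists (Radon_Nikodym nu mu); split.
  - by move=> x; exact: Radon_Nikodym_fin_num.
  - exact: Radon_Nikodym_integrable.
  - by move=> A mA; exact: Radon_Nikodym_integral.
have mf := measurable_int _ intf.
have fK : EFin \o (fine \o f) = f by apply/funext => x /=; rewrite fineK.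
have intPf A : measurable A -> P.-integrable (j @^-1` A) (f \o j).
  move=> mA; have mA' : measurable (j @^-1` A) by rewrite GE in mA; exact: Gm.
  have mfj : measurable_fun setT (f \o j) by exact: measurableT_comp.
  apply/integrableP; split; first exact: measurable_funTS.
  have /integrableP[_] := integrableS measurableT mA (@subsetT _ A) intf.
  rewrite ge0_integral_pushforward//; apply: measurableT_comp => //.
  exact: measurable_funTS.
rewrite /cond_exp; case: xgetP => [Z _ //|/(_ (fine \o f))[]]; split.
- exact: measurableT_comp.
- by rewrite fK; exact: (intPf setT measurableT).
- move=> A GA; have mA : @measurable _ (g_sigma_algebraType G) A by rewrite GE.
  have := fE _ mA; rewrite integral_pushforward//; last exact: intPf.
  by move/esym; rewrite /nu/= /pushforward /induced_charge -[in LHS]fK.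
Qed.

End conditional_expectation.

Section theorem_data.
Context (R : realType) (d d' : measure_display).
Context (Omega : measurableType d) (S : measurableType d').
Variable P : probability Omega R.

Definition cvg_in_probability (Y : nat -> Omega -> R) : Prop :=
  exists Z : {RV P >-> R}, forall e : R, 0 < e ->
    P [set w | e < `|Y n w - Z w|] @[n --> \oo] --> 0%E.

Definition filtration (G : nat -> set (set Omega)) : Prop :=
  [/\ forall n, sigma_algebra setT (G n),
      forall n, G n `<=` measurable &
      forall m n, (m <= n)%N -> G m `<=` G n].

(* The sequence is [X 1, X 2, ...]; the value [X 0] plays no role here nor
   below. For [n = 0] this is the trivial sigma-field. *)
Definition natural_filtration (X : nat -> {RV P >-> S}) (n : nat) :
    set (set Omega) :=
  g_sigma_preimage (fun k : 'I_n => X k.+1 : Omega -> S).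

Definition limit_sigma (G : nat -> set (set Omega)) : set (set Omega) :=
  <<s \bigcup_n G n>>.

Definition alpha (X : nat -> {RV P >-> S}) (n : nat) (f : S -> R) :
    Omega -> R :=
  cond_exp P (natural_filtration X n) (f \o X n.+1).

Definition beta (X : nat -> {RV P >-> S}) (G : nat -> set (set Omega))
    (n : nat) (f : S -> R) : Omega -> R :=
  cond_exp P (G n) (f \o X n.+1).

End theorem_data.

(* Main.v *)
(* Write a_n, b_n for versions of alpha_n(f), beta_n(f) bounded by a bound of f.
   Since G_n is contained in F_n, b_n = E{a_n | G_n}, so Pythagoras gives
   E(a_n^2) = E(b_n^2) + E((a_n - b_n)^2). The assumption on X makes (b_n) a
   bounded (G_n)-martingale, so E(b_n^2) is nondecreasing and (b_n) is Cauchy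
   in L2; hence (b) amounts to a_n - b_n -> 0 in L2, and then (a_n) has the
   limit of (b_n).
   Conversely, D_n = a_n - b_n is orthogonal to G_m for all n >= m, so by the
   pi-lambda theorem E(1_A D_n) -> 0 for every A in G_oo. If G_oo = F_oo then
   each D_m is G_oo-measurable, hence E(D_m D_n) -> 0 as n -> oo; under (a)
   the sequence (D_n) is Cauchy in L1, which forces E(D_n^2) -> 0. *)
Require Import Defs.
From HB Require Import structures.
From mathcomp Require Import all_boot all_order all_algebra.
From mathcomp Require Import all_classical all_reals all_analysis.
From mathcomp Require Import measurable_realfun.
From mathcomp Require Import ring lra.

Set Implicit Arguments.
Unset Strict Implicit.
Unset Printing Implicit Defensive.

Import Order.TTheory GRing.Theory Num.Theory.
Import numFieldNormedType.Exports.
Local Open Scope classical_set_scope.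
Local Open Scope ring_scope.

(** * Closure properties of bounded measurable functions *)

Section bounded_measurable.
Context {R : realType} {d : measure_display} {T : measurableType d}.
Implicit Types (f g : T -> R) (A : set T).

Lemma bounded_measurable_cst (c : R) : bounded_measurable (cst c : T -> R).
Proof. by split; [exact: measurable_cst|exists `|c|]. Qed.

Lemma bounded_measurable_indic A :
  measurable A -> bounded_measurable (\1_A : T -> R).
Proof.
move=> mA; split; first exact: measurable_indic.
by exists 1 => x; rewrite indicE; case: (_ \in _); rewrite ?normr1 ?normr0.
Qed.

Lemma bounded_measurableD f g : bounded_measurable f ->
  bounded_measurable g -> bounded_measurable (fun x => f x + g x).
Proof.
move=> [mf [M fM]] [mg [N gN]]; split; first exact: measurable_funD.
by exists (M + N) => x; rewrite (le_trans (ler_normD _ _))// lerD.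
Qed.

Lemma bounded_measurableM f g : bounded_measurable f ->
  bounded_measurable g -> bounded_measurable (fun x => f x * g x).
Proof.
move=> [mf [M fM]] [mg [N gN]]; split; first exact: measurable_funM.
by exists (M * N) => x; rewrite normrM ler_pM.
Qed.

Lemma bounded_measurableB f g : bounded_measurable f ->
  bounded_measurable g -> bounded_measurable (fun x => f x - g x).
Proof.
move=> [mf [M fM]] [mg [N gN]]; split; first exact: measurable_funB.
by exists (M + N) => x; rewrite (le_trans (ler_normB _ _))// lerD.
Qed.

Lemma bounded_measurable_norm f :
  bounded_measurable f -> bounded_measurable (fun x => `|f x|).
Proof.
move=> [mf [M fM]]; split; first exact: measurableT_comp.
by exists M => x; rewrite normr_id.
Qed.

Lemma bounded_measurableX f :
  bounded_measurable f -> bounded_measurable (fun x => f x ^+ 2).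
Proof. by move=> bf; exact: bounded_measurableM. Qed.

End bounded_measurable.

(** * Measurability with respect to nested sigma-fields, and elementary facts *)

Lemma measurable_fun_sub_sigma (R : realType) (d : measure_display)
    (T : measurableType d) (G H : set (set T)) (f : T -> R) :
  sigma_algebra setT G -> sigma_algebra setT H -> G `<=` H ->
  measurable_fun (setT : set (g_sigma_algebraType G)) f ->
  measurable_fun (setT : set (g_sigma_algebraType H)) f.
Proof.
move=> sG sH GH mf _ B mB; rewrite measurable_g_measurableTypeE//.
by apply: GH; have := mf measurableT B mB; rewrite measurable_g_measurableTypeE.
Qed.

Lemma measurable_fun_of_sigma (R : realType) (d : measure_display)
    (T : measurableType d) (G : set (set T)) (f : T -> R) :
  sigma_algebra setT G -> G `<=` measurable ->
  measurable_fun (setT : set (g_sigma_algebraType G)) f ->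
  measurable_fun setT f.
Proof.
move=> sG Gm mf _ B mB.
by apply: Gm; have := mf measurableT B mB; rewrite measurable_g_measurableTypeE.
Qed.

Lemma measurable_dist_gt (R : realType) (d : measure_display)
    (T : measurableType d) (f g : T -> R) (e : R) : measurable_fun setT f ->
  measurable_fun setT g -> measurable [set w | e < `|f w - g w|].
Proof.
move=> mf mg; rewrite -[X in measurable X]setTI.
rewrite (_ : [set w | _] = (fun w => `|f w - g w|) @^-1` `]e, +oo[%classic).
  by apply: measurableT_comp => //; exact: measurable_funB.
by apply/seteqP; split => w /=; rewrite in_itv/= andbT.
Qed.

Lemma cvg_half_exprn (R : realType) :
  (2^-1 ^+ n : R) @[n --> \oo] --> (0 : R).
Proof.
by apply: cvg_expr; rewrite ger0_norm ?invr_ge0// invf_lt1// ltr1n.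
Qed.

(** * Real-valued integrals of bounded functions under a probability *)

Section integral.
Context {R : realType} {d : measure_display} {Omega : measurableType d}.
Variable P : probability Omega R.
Implicit Types (f g W Y Z : Omega -> R) (G : set (set Omega)).

Lemma bounded_measurable_integrable f :
  bounded_measurable f -> P.-integrable setT (EFin \o f).
Proof.
move=> [mf [M fM]]; apply: measurable_bounded_integrable => //.
  by rewrite -ge0_fin_numE// fin_num_measure.
exists M; split; first exact: num_real.
by move=> N MN x _ /=; apply: (le_trans (fM x)); exact: ltW.
Qed.

Lemma bRintegralD f g : bounded_measurable f -> bounded_measurable g ->
  \int[P]_w (f w + g w) = \int[P]_w f w + \int[P]_w g w.
Proof. by move=> bf bg; rewrite RintegralD//; exact: bounded_measurable_integrable. Qed.

Lemma bRintegralB f g : bounded_measurable f -> bounded_measurable g ->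
  \int[P]_w (f w - g w) = \int[P]_w f w - \int[P]_w g w.
Proof. by move=> bf bg; rewrite RintegralB//; exact: bounded_measurable_integrable. Qed.

Lemma bRintegralZl f (r : R) : bounded_measurable f ->
  \int[P]_w (r * f w) = r * \int[P]_w f w.
Proof. by move=> bf; rewrite RintegralZl//; exact: bounded_measurable_integrable. Qed.

Lemma le_bRintegral f g : bounded_measurable f -> bounded_measurable g ->
  (forall w, f w <= g w) -> \int[P]_w f w <= \int[P]_w g w.
Proof.
by move=> bf bg fg; apply: le_Rintegral => //; exact: bounded_measurable_integrable.
Qed.

Lemma Rintegral_probability_cst (r : R) : \int[P]_w r = r.
Proof. by rewrite Rintegral_cst// [X in _ * fine X]probability_setT mulr1. Qed.

Lemma le_norm_bRintegral f (M : R) : bounded_measurable f ->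
  (forall w, `|f w| <= M) -> `|\int[P]_w f w| <= M.
Proof.
move=> bf fM; rewrite (le_trans (le_normr_Rintegral _ _))//.
  exact: bounded_measurable_integrable.
rewrite -[leRHS]Rintegral_probability_cst le_bRintegral//; first exact: bounded_measurable_norm.
exact: bounded_measurable_cst.
Qed.

Lemma norm_bRintegral f : bounded_measurable f ->
  `|\int[P]_w f w| <= \int[P]_w `|f w|.
Proof. by move=> bf; apply: le_normr_Rintegral => //; exact: bounded_measurable_integrable. Qed.

Lemma EFin_bRintegral f : bounded_measurable f ->
  (\int[P]_w f w)%:E = (\int[P]_w (f w)%:E)%E.
Proof.
move=> bf; rewrite /Rintegral fineK//; apply: integrable_fin_num => //.
exact: bounded_measurable_integrable.
Qed.

Lemma Rintegral_indic A : measurable A -> \int[P]_w (\1_A w : R) = fine (P A).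
Proof. by move=> mA; rewrite /Rintegral integral_indic// setIT. Qed.

Lemma Rintegral_indicE A f : \int[P]_(w in A) f w = \int[P]_w (\1_A w * f w).
Proof.
rewrite Rintegral_mkcond; apply: eq_Rintegral => w _; rewrite indicE patchE.
by case: (_ \in _); rewrite ?mul1r ?mul0r.
Qed.

End integral.

(** * Asymptotic orthogonality to a sigma-field *)

Section orthogonality.
Context {R : realType} {d : measure_display} {Omega : measurableType d}.
Variable P : probability Omega R.

(** Continuity from below of a finite measure. It controls the error in the increasing-union step of
    the lambda-system argument. *)
Lemma measure_bigcup_setD_cvg0 (F : (set Omega)^nat) :
  (forall n, measurable (F n)) -> nondecreasing_seq F ->
  fine (P (\bigcup_k F k `\` F n)) @[n --> \oo] --> (0 : R).
Proof.
move=> mF ndF; set U := \bigcup_k F k.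
have mU : measurable U by exact: bigcup_measurable.
have FU n : F n `<=` U by exact: bigcup_sup.
have -> : (fun n => fine (P (U `\` F n))) = fun n => fine (P U) - fine (P (F n)).
  apply/funext => n; rewrite measureD//; last first.
    by rewrite -ge0_fin_numE// fin_num_measure.
  by rewrite setIidr// fineB// fin_num_measure.
rewrite -(subrr (fine (P U))); apply: cvgB; first exact: cvg_cst.
apply: fine_cvg; rewrite fineK ?fin_num_measure//.
exact: nondecreasing_cvg_mu.
Qed.

(** Pi-lambda argument. Proper differences are handled by linearity. For an increasing union [U] of
    sets [F k], replacing [U] by [F N] changes the integral by at most [M * P (U \ F N)]. This error
    is uniform in [n], so [N] can be fixed before [n] tends to infinity. *)
Lemma sigma_int_cvg0 (C : set (set Omega)) (D : nat -> Omega -> R) (M : R) :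
  setI_closed C -> C setT -> C `<=` measurable ->
  (forall n, measurable_fun setT (D n)) -> (forall n w, `|D n w| <= M) ->
  (forall A, C A -> \int[P]_w (\1_A w * D n w) @[n --> \oo] --> (0 : R)) ->
  forall A, <<s C >> A ->
    \int[P]_w (\1_A w * D n w) @[n --> \oo] --> (0 : R).
Proof.
move=> CI CT Cm mD DM CD.
have bD n : bounded_measurable (D n) by split => //; exists M.
have M0 : 0 <= M by rewrite (le_trans _ (DM 0%N point)).
have bI A n : measurable A -> bounded_measurable (fun w => \1_A w * D n w).
  by move=> mA; apply: bounded_measurableM => //; exact: bounded_measurable_indic.
(* Measurability of [A] is carried along in the class, since splitting the integrals requires it. *)
suff /subset_trans : <<s C >> `<=` [set A | measurable A /\
    \int[P]_w (\1_A w * D n w) @[n --> \oo] --> (0 : R)].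
  by move=> + A CA => /(_ _ (fun A H => proj2 H)); exact.
have indicD A B w : A `<=` B -> \1_(B `\` A) w = \1_B w - \1_A w :> R.
  move=> AB; rewrite !indicE in_setD.
  have [wA|wA] := boolP (w \in A); last by rewrite subr0 andbT.
  by rewrite mem_set ?subrr//; apply: AB; exact: set_mem.
apply: lambda_system_subset => //; last by move=> A CA; split; [exact: Cm|exact: CD].
split => //.
- by split => //; exact: CD.
- move=> B A AB [mB Bcvg] [mA Acvg]; split; first exact: measurableD.
  rewrite -(subrr 0).
  have -> : (fun n => \int[P]_w (\1_(B `\` A) w * D n w)) = fun n =>
      \int[P]_w (\1_B w * D n w) - \int[P]_w (\1_A w * D n w).
    apply/funext => n; rewrite -bRintegralB; [|exact: bI..].
    by apply: eq_Rintegral => w _; rewrite indicD// mulrBl.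
  exact: cvgB.
- move=> F ndF FH; have mF n : measurable (F n) by have [] := FH n.
  set U := \bigcup_k F k.
  have mU : measurable U by exact: bigcup_measurable.
  split => //; apply/cvgr0Pnorm_le => e e0.
  have e20 : 0 < e / 2 by rewrite divr_gt0.
  (* Dividing by [M + 1] instead of [M] covers the case [M = 0]; the factor [M] then leaves at most
     [e / 2]. *)
  have eM : 0 < e / 2 / (M + 1) by rewrite !divr_gt0// ltr_wpDl.
  have /cvgr0Pnorm_le/(_ _ eM)[N _ /(_ N (leqnn N))/= UN] :=
    @measure_bigcup_setD_cvg0 F mF ndF.
  have [_ /cvgr0Pnorm_le/(_ _ e20)] := FH N.
  apply: filterS => n /= FN.
  have FU : F N `<=` U by exact: bigcup_sup.
  have mUF : measurable (U `\` F N) by exact: measurableD.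
  have -> : \int[P]_w (\1_U w * D n w) = \int[P]_w (\1_(F N) w * D n w) +
      \int[P]_w (\1_(U `\` F N) w * D n w).
    rewrite -bRintegralD; [|exact: bI..]; apply: eq_Rintegral => w _.
    by rewrite indicD// mulrBl addrC subrK.
  rewrite (le_trans (ler_normD _ _))// (splitr e) lerD//.
  rewrite (le_trans (norm_bRintegral P (bI _ n mUF)))//.
  apply: (@le_trans _ _ (M * fine (P (U `\` F N)))).
    rewrite -Rintegral_indic// -bRintegralZl; last exact: bounded_measurable_indic.
    apply: le_bRintegral.
    - exact/bounded_measurable_norm/bI.
    - apply: bounded_measurableM; first exact: bounded_measurable_cst.
      exact: bounded_measurable_indic.
    - move=> w; rewrite normrM mulrC indicE.
      by case: (_ \in _); rewrite ?normr1 ?normr0 ?mulr1 ?mulr0.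
  rewrite ger0_norm ?fine_ge0// in UN.
  rewrite (le_trans (ler_wpM2l M0 UN))// mulrCA ler_piMr//.
    by rewrite divr_ge0// ltW.
  by rewrite ler_pdivrMr ?mul1r ?lerDl// ltr_wpDl.
Qed.

(** Extension from indicators to bounded [G]-measurable weights by uniform approximation: as [D n]
    is bounded by [M] for all [n], a uniform error in [W] costs at most [M] times that error,
    whatever [n] is. *)
Lemma int_mul_cvg0 (G : set (set Omega)) (D : nat -> Omega -> R) (M : R)
    (W : Omega -> R) :
  sigma_algebra setT G -> G `<=` measurable ->
  (forall n, measurable_fun setT (D n)) -> (forall n w, `|D n w| <= M) ->
  (forall A, G A -> \int[P]_w (\1_A w * D n w) @[n --> \oo] --> (0 : R)) ->
  bounded_measurable (W : g_sigma_algebraType G -> R) ->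
  \int[P]_w (W w * D n w) @[n --> \oo] --> (0 : R).
Proof.
move=> sG Gm mD DM GD.
have bD n : bounded_measurable (D n) by split => //; exists M.
have M0 : 0 <= M by rewrite (le_trans _ (DM 0%N point)).
have GE : @measurable _ (g_sigma_algebraType G) = G.
  exact: measurable_g_measurableTypeE.
have bG (V : Omega -> R) : bounded_measurable (V : g_sigma_algebraType G -> R) ->
    bounded_measurable V.
  by move=> [mV bV]; split => //; exact: measurable_fun_of_sigma mV.
have bM (V : Omega -> R) n : bounded_measurable (V : g_sigma_algebraType G -> R) ->
    bounded_measurable (fun w : Omega => V w * D n w).
  by move=> bV; exact: bounded_measurableM (bG _ bV) (bD n).
(* Binary expansion: subtracting [B / 2] on [{V >= B / 2}] leaves a function
   with values in [[0, B / 2]]. *)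
have approx k : forall (V : g_sigma_algebraType G -> R) (B : R),
    bounded_measurable V -> (forall w, 0 <= V w <= B) ->
    exists V' : g_sigma_algebraType G -> R, [/\ bounded_measurable V',
      \int[P]_w (V' w * D n w) @[n --> \oo] --> (0 : R) &
      forall w, `|V w - V' w| <= B / 2 ^+ k].
  elim: k => [V B bV VB|k IH V B bV VB].
    exists (cst 0); split; first exact: bounded_measurable_cst.
      under eq_cvg do under eq_Rintegral do rewrite mul0r.
      by rewrite Rintegral_probability_cst; exact: cvg_cst.
    move=> w; rewrite subr0 expr0 divr1.
    by have /andP[V0 VB'] := VB w; rewrite ger0_norm.
  pose A : set (g_sigma_algebraType G) := [set w | B / 2 <= V w].
  have mA : measurable A.
    rewrite -[A]setTI; have [mV _] := bV.
    by rewrite (_ : A = V @^-1` `[B / 2, +oo[%classic);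
      [exact: mV|apply/seteqP; split => w /=; rewrite in_itv/= andbT].
  have GA : G A by rewrite GE in mA.
  have bA : bounded_measurable (\1_A : g_sigma_algebraType G -> R).
    exact: bounded_measurable_indic.
  have bcA : bounded_measurable
      (fun w : g_sigma_algebraType G => B / 2 * \1_A w : R).
    exact: bounded_measurableM (bounded_measurable_cst _) bA.
  have [|w|V' [bV' V'0 VV']] := IH (fun w => V w - B / 2 * \1_A w) (B / 2).
  - exact: bounded_measurableB.
  - have /andP[V0 VB'] := VB w; rewrite indicE.
    have [wA|wA] := leP (B / 2) (V w).
      by rewrite mem_set//= mulr1; apply/andP; split; lra.
    rewrite memNset ?mulr0; last by apply/negP; rewrite -ltNge.
    by apply/andP; split; lra.
  exists (fun w => V' w + B / 2 * \1_A w); split.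
  - exact: bounded_measurableD.
  - have -> : (fun n => \int[P]_w ((V' w + B / 2 * \1_A w) * D n w)) = fun n =>
        \int[P]_w (V' w * D n w) + B / 2 * \int[P]_w (\1_A w * D n w).
      apply/funext => n; rewrite -bRintegralZl; last exact: bM.
      rewrite -bRintegralD; [|exact: bM|].
        by apply: eq_Rintegral => w _; rewrite mulrDl mulrA.
      by apply: bounded_measurableM; [exact: bounded_measurable_cst|exact: bM].
    rewrite -(addr0 0); apply: cvgD => //.
    by rewrite -(mulr0 (B / 2)); apply: cvgMr; exact: GD.
  - move=> w; have := VV' w; rewrite exprS invfM mulrA.
    by congr (`|_| <= _); ring.
move=> bW.
have [_ [N WN]] := bW.
have N0 : 0 <= N by rewrite (le_trans _ (WN point)).
apply/cvgr0Pnorm_le => e e0.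
(* The precision is chosen so that the approximation error times [M] is at most [e / 2]. *)
have [k kN] : exists k, N *+ 2 / 2 ^+ k <= e / 2 / (M + 1).
  have eM : 0 < e / 2 / (M + 1) by rewrite !divr_gt0// ltr_wpDl.
  have /cvgr0Pnorm_le/(_ _ eM)[k _ /(_ k (leqnn k))/= kN] :
      N *+ 2 * (2^-1 ^+ n : R) @[n --> \oo] --> (0 : R).
    by rewrite -(mulr0 (N *+ 2)); apply: cvgMr; exact: cvg_half_exprn.
  by exists k; rewrite -exprVn; exact: le_trans (ler_norm _) kN.
(* [approx] expects values in [[0, B]], so [W] is shifted by its bound [N]. The constant is removed
   afterwards, using convergence on the whole space. *)
have [||V [bV Vcvg WV]] := approx k (fun w => W w + N) (N *+ 2).
- exact: bounded_measurableD bW (bounded_measurable_cst _).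
- move=> w; have := WN w; rewrite ler_norml mulr2n => /andP[? ?].
  by apply/andP; split; lra.
have {}Vcvg : \int[P]_w ((V w - N) * D n w) @[n --> \oo] --> (0 : R).
  have -> : (fun n => \int[P]_w ((V w - N) * D n w)) = fun n =>
      \int[P]_w (V w * D n w) - N * \int[P]_w (\1_setT w * D n w).
    apply/funext => n; rewrite -bRintegralZl; last first.
      exact: bounded_measurableM (bounded_measurable_indic measurableT) (bD n).
    rewrite -bRintegralB; [|exact: bM|].
      by apply: eq_Rintegral => w _; rewrite indicT mulrBl mul1r.
    apply: bounded_measurableM; first exact: bounded_measurable_cst.
    exact: bounded_measurableM (bounded_measurable_indic measurableT) (bD n).
  rewrite -(subr0 0); apply: cvgB => //.
  rewrite -(mulr0 N); apply: cvgMr; apply: GD.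
  by case: sG => G0 GC _; have := GC _ G0; rewrite setD0.
have /cvgr0Pnorm_le/(_ (e / 2)) := Vcvg.
rewrite divr_gt0// => /(_ isT); apply: filterS => n Vn.
have bVN : bounded_measurable (fun w : g_sigma_algebraType G => V w - N).
  exact: bounded_measurableB bV (bounded_measurable_cst _).
have bWV : bounded_measurable
    (fun w : g_sigma_algebraType G => W w - (V w - N)).
  exact: bounded_measurableB.
have -> : \int[P]_w (W w * D n w) = \int[P]_w ((V w - N) * D n w) +
    \int[P]_w ((W w - (V w - N)) * D n w).
  rewrite -bRintegralD; [|exact: bM..].
  by apply: eq_Rintegral => w _; rewrite -mulrDl addrC subrK.
rewrite (le_trans (ler_normD _ _))// (splitr e) lerD//.
apply: le_norm_bRintegral; first exact: bM.
move=> w; rewrite normrM.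
have -> : W w - (V w - N) = W w + N - V w by ring.
apply: (@le_trans _ _ (e / 2 / (M + 1) * M)).
  by apply: ler_pM => //; exact: le_trans (WV w) kN.
rewrite mulrAC ler_pdivrMr ?ler_wpM2l//; first exact/ltW/divr_gt0.
  by rewrite lerDl.
by rewrite ltr_wpDl.
Qed.
End orthogonality.

(** * Truncation to a symmetric interval *)

Section clip.
Context {R : realType}.
Implicit Types M x : R.

Definition clip M x : R := Num.max (- M) (Num.min M x).

Lemma clip_id M x : `|x| <= M -> clip M x = x.
Proof.
by rewrite /clip ler_norml => /andP[Mx xM]; rewrite (min_idPr xM) (max_idPr Mx).
Qed.

Lemma norm_clip M x : 0 <= M -> `|clip M x| <= M.
Proof.
move=> M0; rewrite /clip ler_norml le_max lexx/= ge_max ge_min lexx/=.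
by rewrite (le_trans _ M0)// oppr_le0.
Qed.

Lemma measurable_clip (d : measure_display) (T : measurableType d) M
    (f : T -> R) :
  measurable_fun setT f -> measurable_fun setT (fun w => clip M (f w)).
Proof.
move=> mf; apply: measurable_maxr; first exact: measurable_cst.
by apply: measurable_minr => //; exact: measurable_cst.
Qed.

End clip.

(** * Conditional expectations: Pythagoras and bounded versions *)

Section conditional_expectation.
Context {R : realType} {d : measure_display} {Omega : measurableType d}.
Variable P : probability Omega R.
Implicit Types (W V Y Z : Omega -> R) (G : set (set Omega)).

Lemma Rintegral_ae_eq Y Z : measurable_fun setT Y -> measurable_fun setT Z ->
  Y = Z %[ae P] -> \int[P]_w Y w = \int[P]_w Z w.
Proof.
move=> mY mZ YZ; congr fine; apply: ae_eq_integral => //.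
- exact/measurable_EFinP.
- exact/measurable_EFinP.
- by apply: filterS YZ => w /= YZw /YZw ->.
Qed.

Lemma bounded_measurable_sub_sigma G Z : sigma_algebra setT G ->
  G `<=` measurable -> bounded_measurable (Z : g_sigma_algebraType G -> R) ->
  bounded_measurable Z.
Proof.
by move=> sG Gm [mZ bZ]; split => //; exact: measurable_fun_of_sigma mZ.
Qed.

(** Case of a constant sequence in [int_mul_cvg0]: a constant that tends to 0 is 0. *)
Lemma Rintegral_mul_eq0 G W Y : sigma_algebra setT G -> G `<=` measurable ->
  bounded_measurable Y -> (forall A, G A -> \int[P]_w (\1_A w * Y w) = 0) ->
  bounded_measurable (W : g_sigma_algebraType G -> R) ->
  \int[P]_w (W w * Y w) = 0.
Proof.
move=> sG Gm [mY [M YM]] GY bW.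
have cW : \int[P]_w (W w * Y w) @[_ --> (\oo : set_system nat)] --> (0 : R).
  apply: (@int_mul_cvg0 _ _ _ P G (fun=> Y) M W) => // A GA.
  by rewrite GY//; exact: cvg_cst.
by rewrite -(cvg_lim (@Rhausdorff R) cW) lim_cst.
Qed.

(** Pythagoras for [W] as the projection of [V] on the [G]-measurable functions: [V - W] is
    orthogonal to [W], which is itself [G]-measurable. *)
Lemma Rintegral_sqr_decomp G W V : sigma_algebra setT G -> G `<=` measurable ->
  bounded_measurable V -> bounded_measurable (W : g_sigma_algebraType G -> R) ->
  (forall A, G A -> \int[P]_w (\1_A w * V w) = \int[P]_w (\1_A w * W w)) ->
  \int[P]_w (V w ^+ 2) = \int[P]_w (W w ^+ 2) + \int[P]_w ((V w - W w) ^+ 2).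
Proof.
move=> sG Gm bV bGW VW.
have bW : bounded_measurable W by exact: bounded_measurable_sub_sigma bGW.
have bVW : bounded_measurable (fun w => V w - W w) by exact: bounded_measurableB.
have WVW0 : \int[P]_w (W w * (V w - W w)) = 0.
  apply: (@Rintegral_mul_eq0 G) => // A GA; have mA := Gm _ GA.
  transitivity (\int[P]_w (\1_A w * V w - \1_A w * W w)).
    by apply: eq_Rintegral => w _; rewrite mulrBr.
  by rewrite bRintegralB ?VW ?subrr//; apply: bounded_measurableM => //;
    exact: bounded_measurable_indic.
(* The vanishing cross term, taken twice, is added in order to complete the square under one
   integral. *)
rewrite -[RHS]addr0 -[X in _ = _ + X](mulr0 2) -WVW0.
have bWVW : bounded_measurable (fun w => W w * (V w - W w)).
  exact: bounded_measurableM.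
rewrite -bRintegralZl// -bRintegralD; [|exact: bounded_measurableX..].
rewrite -bRintegralD; first by apply: eq_Rintegral => w _; ring.
- by apply: bounded_measurableD; exact: bounded_measurableX.
- exact: bounded_measurableM (bounded_measurable_cst _) _.
Qed.

(** The set [A] where [Z] exceeds [M] belongs to [G], so [Z - M] and [Y - M] have the same integral
    over it. That integral is at most 0 while [Z - M] is positive on [A], hence [A] is null. *)
Lemma is_cond_exp_le G Y Z (M : R) : sigma_algebra setT G ->
  G `<=` measurable -> bounded_measurable Y -> is_cond_exp P G Y Z ->
  (forall w, Y w <= M) -> {ae P, forall w, Z w <= M}.
Proof.
move=> sG Gm bY [mZ iZ ZY] YM.
pose A := [set w | M < Z w].
have GA : G A.
  rewrite -(measurable_g_measurableTypeE sG) -[A]setTI.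
  rewrite (_ : A = Z @^-1` `]M, +oo[%classic); first exact: mZ.
  by apply/seteqP; split => w /=; rewrite in_itv/= andbT.
have mA := Gm _ GA.
have iY := bounded_measurable_integrable P bY.
have iM : P.-integrable setT (EFin \o cst M).
  exact/bounded_measurable_integrable/bounded_measurable_cst.
have sub f : P.-integrable setT f -> P.-integrable A f.
  by apply: integrableS.
have iZM : P.-integrable A (EFin \o (fun w => Z w - M)).
  apply: eq_integrable (integrableB mA (sub _ iZ) (sub _ iM)) => //.
have : \int[P]_(w in A) (Z w - M) <= 0.
  rewrite RintegralB//; [|exact: sub..].
  rewrite {1}/Rintegral ZY// -/(Rintegral P A Y) -RintegralB//; [|exact: sub..].
  rewrite (@le_trans _ _ (\int[P]_(w in A) 0))//; last first.
    by rewrite Rintegral_cst// mul0r.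
  apply: le_Rintegral => //.
  - apply: eq_integrable (integrableB mA (sub _ iY) (sub _ iM)) => //.
  - exact/sub/bounded_measurable_integrable/bounded_measurable_cst.
  - by move=> w _; rewrite subr_le0.
move=> ZM0.
have ZM w : A w -> (`|(Z w - M)%:E| = (Z w - M)%:E)%E.
  by move=> Aw; rewrite gee0_abs// lee_fin subr_ge0 ltW.
have : (\int[P]_(w in A) `|(Z w - M)%:E| = 0)%E.
  rewrite (eq_integral (fun w => (Z w - M)%:E)); last first.
    by move=> w /set_mem; exact: ZM.
  have fZM := integrable_fin_num mA iZM.
  rewrite -(fineK fZM); congr EFin; apply/eqP; rewrite eq_le ZM0/=.
  by apply: Rintegral_ge0 => w Aw; rewrite subr_ge0 ltW.
have mZM := measurable_int _ iZM.
move=> /(ae_eq_integral_abs P mA mZM); apply: filterS => w /= AZ.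
rewrite leNgt; apply/negP => Aw.
by have [/eqP] := AZ Aw; rewrite subr_eq0 gt_eqF.
Qed.

(** Lets [is_cond_exp_le] give lower bounds as well. *)
Lemma is_cond_expN G Y Z : G `<=` measurable ->
  P.-integrable setT (EFin \o Y) -> is_cond_exp P G Y Z ->
  is_cond_exp P G (fun w => - Y w) (fun w => - Z w).
Proof.
move=> Gm iY [mZ iZ ZY]; split.
- exact: measurableT_comp.
- exact: integrableN iZ.
- move=> A GA; have mA := Gm _ GA.
  have NE f : P.-integrable setT (EFin \o f) ->
      (\int[P]_(w in A) (- f w)%:E = - \int[P]_(w in A) (f w)%:E)%E.
    move=> /(integrableS measurableT mA (@subsetT _ A)) iF.
    under eq_integral do rewrite -mulN1r EFinM.
    by rewrite integralZl// mulN1e.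
  by rewrite !NE// ZY.
Qed.

(** The chosen [cond_exp] obeys the bound of [Y] only almost surely. Clipping it changes it on a
    null set, keeps it [G]-measurable, and makes the bound hold at every point, as
    [bounded_measurable] demands. *)
Lemma bounded_cond_exp G Y (M : R) : sigma_algebra setT G ->
  G `<=` measurable -> measurable_fun setT Y -> (forall w, `|Y w| <= M) ->
  exists Z : Omega -> R,
    [/\ measurable_fun (setT : set (g_sigma_algebraType G)) Z,
        forall w, `|Z w| <= M, cond_exp P G Y = Z %[ae P] &
        forall A, G A ->
          \int[P]_w (\1_A w * Z w) = \int[P]_w (\1_A w * Y w)].
Proof.
move=> sG Gm mY YM.
have bY : bounded_measurable Y by split => //; exists M.
have M0 : 0 <= M by rewrite (le_trans _ (YM point)).
have iY := bounded_measurable_integrable P bY.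
have ce := cond_expP sG Gm iY.
have [mZ0 iZ0 ceE] := ce.
have mZ : measurable_fun (setT : set (g_sigma_algebraType G))
  (fun w => clip M (cond_exp P G Y w)) by exact: measurable_clip.
exists (fun w => clip M (cond_exp P G Y w)).
have aeZ : cond_exp P G Y = fun w => clip M (cond_exp P G Y w) %[ae P].
  have := is_cond_exp_le sG Gm bY ce (fun w => ler_normlW (YM w)).
  have bNY : bounded_measurable (fun w => - Y w).
    by split; [exact: measurableT_comp|exists M => w; rewrite normrN].
  have NYM w : - Y w <= M by rewrite (le_trans (ler_norm _))// normrN.
  have := is_cond_exp_le sG Gm bNY (is_cond_expN Gm iY ce) NYM.
  apply: filterS2 => w ZM NZM _; rewrite clip_id//.
  by rewrite ler_norml lerNl ZM NZM.
split => //; first by move=> w; exact: norm_clip.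
move=> A GA; have mA := Gm _ GA.
rewrite -[RHS]Rintegral_indicE /Rintegral -ceE// -/(Rintegral P A _) Rintegral_indicE.
apply: Rintegral_ae_eq.
- apply: measurable_funM; first exact: measurable_indic.
  exact: measurable_fun_of_sigma mZ.
- apply: measurable_funM; first exact: measurable_indic.
  exact: measurable_fun_of_sigma mZ0.
- by apply: filterS aeZ => w /= /[apply] <-.
Qed.

End conditional_expectation.

(** * Bounded sequences: convergence in L1 and in probability *)

Section convergence.
Context {R : realType} {d : measure_display} {Omega : measurableType d}.
Variable P : probability Omega R.

Definition L1_cauchy (f : nat -> Omega -> R) : Prop :=
  forall e : R, 0 < e -> exists N : nat, forall m n : nat,
    (N <= m)%N -> (N <= n)%N -> \int[P]_w `|f m w - f n w| <= e.

Lemma bounded_measurable_dist (f g : Omega -> R) : bounded_measurable f ->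
  bounded_measurable g -> bounded_measurable (fun w => `|f w - g w|).
Proof. by move=> bf bg; exact/bounded_measurable_norm/bounded_measurableB. Qed.

Lemma Rintegral_dist_triangle (f g h : Omega -> R) :
  bounded_measurable f -> bounded_measurable g -> bounded_measurable h ->
  \int[P]_w `|f w - h w| <=
    \int[P]_w `|f w - g w| + \int[P]_w `|g w - h w|.
Proof.
move=> bf bg bh; rewrite -bRintegralD; [|exact: bounded_measurable_dist..].
apply: le_bRintegral => [||w]; [exact: bounded_measurable_dist| |exact: ler_distD].
by apply: bounded_measurableD; exact: bounded_measurable_dist.
Qed.

(** The telescoping series of [u] converges absolutely, and its partial sums are [u n - u 0]. *)
Lemma cvgn_of_summable_dist (u : nat -> R) :
  (\sum_(k <oo) `|u k.+1 - u k|%:E < +oo)%E -> cvgn u.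
Proof.
move=> u_sum; suff : cvgn (series (telescope u)).
  rewrite telescopeK => cu.
  rewrite (_ : u = (fun n => (u n - u 0%N) + u 0%N)); last first.
    by apply/funext => n; rewrite subrK.
  by apply: is_cvgD => //; exact: is_cvg_cst.
apply: normed_cvg; apply: nondecreasing_is_cvgn.
  by apply: nondecreasing_series => n _ _; exact: normr_ge0.
exists (fine (\sum_(k <oo) `|u k.+1 - u k|%:E)%E) => _ [n _ <-].
have S0 : (0 <= \sum_(k <oo) `|u k.+1 - u k|%:E)%E.
  by apply: nneseries_ge0 => k _ _; rewrite lee_fin.
rewrite -lee_fin fineK ?ge0_fin_numE//.
apply: le_trans (nneseries_lim_ge n _); first by rewrite sumEFin.
by move=> k _ _; rewrite lee_fin.
Qed.

(** Riesz-Fischer argument: along a subsequence the increments have summable L1 norms, so the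
    subsequence converges almost surely, and in L1 by dominated convergence. The Cauchy property
    carries the limit over to the whole sequence. *)
Lemma L1_cauchy_cvg (f : nat -> Omega -> R) (M : R) :
  (forall n, measurable_fun setT (f n)) -> (forall n w, `|f n w| <= M) ->
  L1_cauchy f ->
  exists Z : Omega -> R, bounded_measurable Z /\
    \int[P]_w `|f n w - Z w| @[n --> \oo] --> (0 : R).
Proof.
move=> mf fM cf.
have M0 : 0 <= M by rewrite (le_trans _ (fM 0%N point)).
have bf n : bounded_measurable (f n) by split => //; exists M.
have /choice[u uP] : forall k : nat, exists N : nat, forall m n : nat,
    (N <= m)%N -> (N <= n)%N -> \int[P]_w `|f m w - f n w| <= 2^-1 ^+ k.
  by move=> k; apply: cf; rewrite exprn_gt0.
(* Partial sums turn the thresholds [u] into nondecreasing indices [v k] with [u k <= v k]. *)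
pose v k := (\sum_(i < k.+1) u i)%N.
have uv k : (u k <= v k)%N by rewrite /v big_ord_recr/= leq_addl.
have v_nd k : (v k <= v k.+1)%N by rewrite /v [leqRHS]big_ord_recr/= leq_addr.
pose h k w := `|f (v k.+1) w - f (v k) w|.
have h0 k w : (0 <= (h k w)%:E)%E by rewrite lee_fin normr_ge0.
have bh k : bounded_measurable (h k) by exact: bounded_measurable_dist.
have h_sum : (\int[P]_w (\sum_(k <oo) (h k w)%:E) <= 2%:E)%E.
  rewrite integral_nneseries//; last first.
    by move=> k; apply/measurable_EFinP; have [] := bh k.
  apply: lime_le.
    by apply: is_cvg_nneseries => k _ _; apply: integral_ge0.
  apply: nearW => n.
  rewrite (eq_bigr (fun k => (\int[P]_w h k w)%:E)); last first.
    by move=> k _; rewrite EFin_bRintegral.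
  rewrite sumEFin lee_fin.
  apply: (@le_trans _ _ (series (geometric 1 2^-1) n)).
    rewrite seriesEnat/=; apply: ler_sum => k _; rewrite mul1r.
    by apply: uP; rewrite // (leq_trans (uv k)).
  rewrite (le_trans (geometric_le_lim _ _ _ _))//.
    by rewrite ger0_norm// invf_lt1// ltr1n.
  by rewrite mul1r (_ : 1 - 2^-1 = 2^-1) ?invrK//; field.
have ae_cvg : {ae P, forall w, cvgn (fun k => f (v k) w)}.
  have mS : measurable_fun setT (fun w => \sum_(k <oo) (h k w)%:E)%E.
    apply: ge0_emeasurable_sum => [//|k _].
    by apply/measurable_EFinP; have [] := bh k.
  have iS : P.-integrable setT (fun w => \sum_(k <oo) (h k w)%:E)%E.
    apply/integrableP; split => //.
    under eq_integral => w _.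
      rewrite gee0_abs; last by apply: nneseries_ge0.
      over.
    exact: le_lt_trans h_sum (ltry _).
  apply: filterS (integrable_ae measurableT iS) => w /= /(_ Logic.I) hw.
  by apply: cvgn_of_summable_dist; rewrite ltey_eq hw.
(* The upper limit is measurable and is the limit wherever the subsequence converges; clipping
   supplies the bound at every point and changes nothing at points of convergence. *)
pose Z w := clip M (limn_sup (fun k => f (v k) w)).
have mZ : measurable_fun setT Z.
  apply: measurable_clip; apply: measurable_fun_limn_sup => [w _|w _|//].
  - by exists M => _ [k _ <-]; exact: ler_normlW.
  - by exists (- M) => _ [k _ <-]; have := fM (v k) w; rewrite ler_norml => /andP[].
have bZ : bounded_measurable Z by split => //; exists M => w; exact: norm_clip.
exists Z; split => //.
have ZE : {ae P, forall w, setT w -> (EFin \o f (v k)) w @[k --> \oo] --> (EFin \o Z) w}.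
  apply: filterS ae_cvg => w cw _; apply: cvg_EFin; first exact: nearW.
  rewrite /= /Z cvg_limn_supE// clip_id//.
  rewrite ler_norml; apply/andP; split.
    apply: limr_ge => //; apply: nearW => k.
    by have := fM (v k) w; rewrite ler_norml => /andP[].
  by apply: limr_le => //; apply: nearW => k; exact: ler_normlW.
have [||||_ + _] := @dominated_convergence _ _ _ P setT measurableT
  (fun k => EFin \o f (v k)) (EFin \o Z) (cst M%:E) _ _ ZE.
- by move=> k; exact/measurable_EFinP.
- exact/measurable_EFinP.
- exact/bounded_measurable_integrable/bounded_measurable_cst.
- by apply: aeW => w k _; rewrite lee_fin.
move=> fvZ.
have {}fvZ : \int[P]_w `|f (v k) w - Z w| @[k --> \oo] --> (0 : R).
  exact: fine_cvg fvZ.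
apply/cvgr0Pnorm_le => e e0.
have e20 : 0 < e / 2 by rewrite divr_gt0.
have /cvgr0Pnorm_le/(_ _ e20)[K1 _ K1P] := fvZ.
have /cvgr0Pnorm_le/(_ _ e20)[K2 _ K2P] := @cvg_half_exprn R.
(* [K1] makes [f (v k)] close to [Z]; [K2] makes [2^-1 ^+ k], which bounds the distance from [f n]
   to [f (v k)], at most [e / 2]. *)
pose k := maxn K1 K2.
exists (u k) => // n /= un; rewrite ger0_norm ?Rintegral_ge0//.
rewrite (le_trans (Rintegral_dist_triangle (bf n) (bf (v k)) bZ))//.
rewrite (splitr e) lerD//.
  by rewrite (le_trans (uP _ _ _ un (uv k)))// (le_trans (ler_norm _))// K2P//= leq_maxr.
by rewrite (le_trans (ler_norm _))// K1P//= leq_maxl.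
Qed.

(** Integrates a pointwise inequality obtained by completing the square. It replaces Cauchy-Schwarz
    in passing from L2 to L1: a second moment of order [e ^+ 2] gives an L1 norm of order [e]. *)
Lemma Rintegral_norm_le_sqr (f : Omega -> R) (e : R) : 0 < e -> bounded_measurable f ->
  \int[P]_w `|f w| <= e + e^-1 * \int[P]_w (f w ^+ 2).
Proof.
move=> e0 bf; have bf2 := bounded_measurableX bf.
have bef : bounded_measurable (fun w => e^-1 * f w ^+ 2).
  exact: bounded_measurableM (bounded_measurable_cst _) bf2.
rewrite -bRintegralZl// -[X in _ <= X + _](Rintegral_probability_cst P) -bRintegralD//; last first.
  exact: bounded_measurable_cst.
apply: le_bRintegral; first exact: bounded_measurable_norm.
  exact: bounded_measurableD (bounded_measurable_cst _) bef.
move=> w; rewrite -(real_normK (num_real (f w))); set x := `|f w|.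
rewrite -subr_ge0 (_ : _ - _ = ((x - e / 2) ^+ 2 + 3 / 4 * e ^+ 2) / e).
  by rewrite divr_ge0 ?addr_ge0 ?sqr_ge0 ?mulr_ge0 ?ltW.
by field; exact: lt0r_neq0.
Qed.

(** Markov's inequality. *)
Lemma L1_cvg_in_probability (f : nat -> Omega -> R) (Z : Omega -> R) :
  (forall n, bounded_measurable (f n)) -> bounded_measurable Z ->
  \int[P]_w `|f n w - Z w| @[n --> \oo] --> (0 : R) ->
  forall e : R, 0 < e -> P [set w | e < `|f n w - Z w|] @[n --> \oo] --> 0%E.
Proof.
move=> bf bZ fZ e e0.
have mA n : measurable [set w | e < `|f n w - Z w|].
  by apply: measurable_dist_gt; [have [] := bf n|have [] := bZ].
have PE n : P [set w | e < `|f n w - Z w|] =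
    (fine (P [set w | e < `|f n w - Z w|]))%:E by rewrite fineK// fin_num_measure.
under eq_cvg do rewrite PE.
apply: cvg_EFin; first exact: nearW.
apply: (@squeeze_cvgr _ _ _ _ (cst 0) (fun n => e^-1 * \int[P]_w `|f n w - Z w|)).
- apply: nearW => n; rewrite /= fine_ge0//= ler_pdivlMl//.
  have b1 : bounded_measurable (\1_[set w | e < `|f n w - Z w|] : Omega -> R).
    exact: bounded_measurable_indic.
  rewrite -Rintegral_indic// -bRintegralZl//; apply: le_bRintegral.
  + exact: bounded_measurableM (bounded_measurable_cst _) b1.
  + exact: bounded_measurable_dist.
  + move=> w; rewrite indicE; have [wA|wA] := ltP e `|f n w - Z w|.
      by rewrite mem_set//= mulr1 ltW.
    by rewrite memNset ?mulr0//; apply/negP; rewrite -leNgt.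
- exact: cvg_cst.
- by rewrite -(mulr0 e^-1); exact: cvgMr.
Qed.

(** Outside the exceptional sets [A m] and [A n] the distance between [f m] and [f n] is at most
    [e / 2] by the triangle inequality through [Z]. On these sets it is at most [2 * M], and their
    probabilities are small. *)
Lemma cvg_in_probability_L1_cauchy (f : nat -> Omega -> R) (Z : Omega -> R)
    (M : R) :
  (forall n, measurable_fun setT (f n)) -> (forall n w, `|f n w| <= M) ->
  measurable_fun setT Z ->
  (forall e : R, 0 < e -> P [set w | e < `|f n w - Z w|] @[n --> \oo] --> 0%E) ->
  L1_cauchy f.
Proof.
move=> mf fM mZ fZ e e0.
have M0 : 0 <= M by rewrite (le_trans _ (fM 0%N point)).
have bf n : bounded_measurable (f n) by split => //; exists M.
pose A n := [set w | e / 4 < `|f n w - Z w|].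
have mA n : measurable (A n) by exact: measurable_dist_gt.
have e4 : 0 < e / 4 by rewrite divr_gt0.
(* Each exceptional set then contributes at most [2 * M] times this number, hence at most [e / 4];
   the total is [e / 2 + e / 4 + e / 4]. *)
have eM : 0 < e / 8 / (M + 1) by rewrite !divr_gt0// ltr_wpDl.
have /fine_cvg/cvgr0Pnorm_le/(_ _ eM)[N _ PN] := fZ _ e4.
exists N => m n Nm Nn.
have b1 k : bounded_measurable (\1_(A k) : Omega -> R).
  exact: bounded_measurable_indic.
have bM1 k : bounded_measurable (fun w => 2 * M * \1_(A k) w).
  exact: bounded_measurableM (bounded_measurable_cst _) (b1 k).
have PA k : (N <= k)%N -> 2 * M * \int[P]_w \1_(A k) w <= e / 4.
  move=> Nk; rewrite Rintegral_indic//; have := PN k Nk.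
  rewrite /= ger0_norm ?fine_ge0// => PAk.
  have M20 : 0 <= 2 * M by rewrite mulr_ge0.
  apply: (le_trans (ler_wpM2l M20 PAk)).
  rewrite -subr_ge0 (_ : _ - _ = e / 4 / (M + 1)).
    by rewrite !divr_ge0 ?ltW// ltr_wpDl.
  by field; rewrite gt_eqF// ltr_wpDl.
apply: (@le_trans _ _ (\int[P]_w (e / 2 + (2 * M * \1_(A m) w + 2 * M * \1_(A n) w)))).
  apply: le_bRintegral => [||w].
  - exact: bounded_measurable_dist.
  - apply: bounded_measurableD; first exact: bounded_measurable_cst.
    exact: bounded_measurableD.
  have := ler_distD (Z w) (f m w) (f n w); rewrite (distrC (Z w)).
  have := ler_normB (f m w) (f n w); have := fM m w; have := fM n w.
  rewrite !indicE.
  have [wm|wm] := ltP (e / 4) `|f m w - Z w|.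
    rewrite (mem_set (wm : A m w))/=.
    case: (w \in A n) => /=; lra.
  have [wn|wn] := ltP (e / 4) `|f n w - Z w|.
    rewrite (mem_set (wn : A n w))/=.
    case: (w \in A m) => /=; lra.
  rewrite !memNset /=; first lra.
  - by apply/negP; rewrite -leNgt.
  - by apply/negP; rewrite -leNgt.
rewrite bRintegralD; [|exact: bounded_measurable_cst|exact: bounded_measurableD].
rewrite bRintegralD// Rintegral_probability_cst !bRintegralZl//.
have := PA m Nm; have := PA n Nn; lra.
Qed.

End convergence.

(** * Bounded martingales and sequences projecting onto them *)

Section martingale.
Context {R : realType} {d : measure_display} {Omega : measurableType d}.
Variables (P : probability Omega R) (G : nat -> set (set Omega)).
Variables (b : nat -> Omega -> R) (M : R).
Hypothesis filG : filtration G.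
Hypothesis mb :
  forall n, measurable_fun (setT : set (g_sigma_algebraType (G n))) (b n).
Hypothesis bM : forall n w, `|b n w| <= M.

Let sG n : sigma_algebra setT (G n). Proof. by case: filG. Qed.
Let Gm n : G n `<=` measurable. Proof. by case: filG. Qed.

Let bbG n : bounded_measurable (b n : g_sigma_algebraType (G n) -> R).
Proof. by split; [exact: mb|exists M]. Qed.

Let bb n : bounded_measurable (b n).
Proof. exact: bounded_measurable_sub_sigma (bbG n). Qed.

Let M0 : 0 <= M. Proof. exact: le_trans (normr_ge0 _) (bM 0 point). Qed.

Section convergence.
Hypothesis b_martingale : forall m n A, (m <= n)%N -> G m A ->
  \int[P]_w (\1_A w * b n w) = \int[P]_w (\1_A w * b m w).

Let b_decomp m n : (m <= n)%N -> \int[P]_w (b n w ^+ 2) =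
  \int[P]_w (b m w ^+ 2) + \int[P]_w ((b n w - b m w) ^+ 2).
Proof.
by move=> mn; apply: (@Rintegral_sqr_decomp _ _ _ P (G m)) => // A; exact: b_martingale.
Qed.

(** By Pythagoras the second moments are nondecreasing, and they are bounded by [M ^+ 2]. *)
Lemma martingale_sqr_cvg : cvgn (fun n => \int[P]_w (b n w ^+ 2)).
Proof.
apply: nondecreasing_is_cvgn => [m n mn|].
  by rewrite (b_decomp mn) lerDl Rintegral_ge0// => w _; exact: sqr_ge0.
exists (M ^+ 2) => _ [n _ <-]; rewrite -[leRHS](Rintegral_probability_cst P); apply: le_bRintegral.
- exact: bounded_measurableX.
- exact: bounded_measurable_cst.
- by move=> w; rewrite -real_normK ?num_real// lerXn2r// nnegrE.
Qed.

(** The second moment of an increment is the difference of two second moments, which is small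
    because these converge. *)
Lemma martingale_L1_cauchy : L1_cauchy P b.
Proof.
move=> e e0; have e2 : 0 < e ^+ 2 / 8 by rewrite divr_gt0// exprn_gt0.
have /cvgrPdist_le/(_ _ e2)[N _ NP] := martingale_sqr_cvg.
set l := limn _ in NP.
have le_dist m n : (m <= n)%N -> (N <= m)%N -> \int[P]_w `|b n w - b m w| <= e.
  move=> mn Nm; have Nn := leq_trans Nm mn.
  have e20 : 0 < e / 2 by rewrite divr_gt0.
  (* Both second moments lie within [e ^+ 2 / 8] of their limit, so the increment has second moment
     at most [e ^+ 2 / 4]; at scale [e / 2] the bound is [e / 2 + e / 2]. *)
  apply: (le_trans (Rintegral_norm_le_sqr P e20 (bounded_measurableB (bb n) (bb m)))).
  have /= := NP m Nm; have /= := NP n Nn; rewrite (b_decomp mn).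
  set x := \int[P]_w (b m w ^+ 2); set y := \int[P]_w _.
  rewrite !ler_norml => /andP[? ?] /andP[? ?].
  have : y <= e ^+ 2 / 4 by lra.
  have e2V0 : 0 <= (e / 2)^-1 by rewrite invr_ge0 ltW.
  move=> /(ler_wpM2l e2V0).
  rewrite (_ : (e / 2)^-1 * (e ^+ 2 / 4) = e / 2); last by field; exact: lt0r_neq0.
  lra.
exists N => m n Nm Nn; have [mn|/ltnW nm] := leqP m n; last exact: le_dist.
by under eq_Rintegral do rewrite distrC; exact: le_dist.
Qed.

End convergence.

Variable a : nat -> Omega -> R.
Hypothesis ma : forall n, measurable_fun setT (a n).
Hypothesis aM : forall n w, `|a n w| <= M.
Hypothesis ab : forall n A, G n A ->
  \int[P]_w (\1_A w * a n w) = \int[P]_w (\1_A w * b n w).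

Let ba n : bounded_measurable (a n). Proof. by split => //; exists M. Qed.

Lemma projection_sqr_dist n : \int[P]_w (a n w ^+ 2) =
  \int[P]_w (b n w ^+ 2) + \int[P]_w ((a n w - b n w) ^+ 2).
Proof. by apply: (@Rintegral_sqr_decomp _ _ _ P (G n)) => // A; exact: ab. Qed.

(** For [A] in [G m] the integral is exactly 0 once [n >= m]. The union of the [G n] is a pi-system
    because the [G n] are nested, so [sigma_int_cvg0] applies. *)
Lemma limit_sigma_int_cvg0 A : limit_sigma G A ->
  \int[P]_w (\1_A w * (a n w - b n w)) @[n --> \oo] --> (0 : R).
Proof.
have [_ _ G_nd] := filG.
apply: (@sigma_int_cvg0 _ _ _ _ (\bigcup_n G n) (fun n w => a n w - b n w) (M + M)).
- move=> B C [m _ GB] [n _ GC]; exists (maxn m n) => //.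
  rewrite -(measurable_g_measurableTypeE (sG (maxn m n))).
  by apply: measurableI; rewrite measurable_g_measurableTypeE//;
    [apply: G_nd GB; exact: leq_maxl|apply: G_nd GC; exact: leq_maxr].
- by exists 0%N => //; have [G0 GC _] := sG 0; have := GC _ G0; rewrite setD0.
- by move=> B [n _]; exact: Gm.
- by move=> n; apply: measurable_funB => //; have [] := bb n.
- by move=> n w; rewrite (le_trans (ler_normB _ _))// lerD.
- move=> B [m _ GB]; apply: cvg_near_cst; exists m => // n /= mn.
  have mB := Gm GB.
  have bB : bounded_measurable (\1_B : Omega -> R) by exact: bounded_measurable_indic.
  under eq_Rintegral do rewrite mulrBr.
  rewrite bRintegralB; [|exact: bounded_measurableM..].
  by rewrite ab ?subrr//; exact: G_nd GB.
Qed.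

(** With [m] frozen, [D n ^+ 2] splits into [D m * D n], whose integral tends to 0 by orthogonality
    in the limit, and [(D n - D m) * D n], controlled by the bound on [D n] and the L1 Cauchy
    property. *)
Lemma projection_dist_cvg0 : L1_cauchy P a -> L1_cauchy P b ->
  (forall n, measurable_fun
    (setT : set (g_sigma_algebraType (limit_sigma G))) (a n)) ->
  \int[P]_w ((a n w - b n w) ^+ 2) @[n --> \oo] --> (0 : R).
Proof.
move=> ca cb mGa; pose D n w := a n w - b n w.
have sGoo : sigma_algebra setT (limit_sigma G) by exact: smallest_sigma_algebra.
have Goom : limit_sigma G `<=` measurable.
  apply: smallest_sub; first exact: sigma_algebra_measurable.
  by move=> B [n _]; exact: Gm.
have bD n : bounded_measurable (D n) by exact: bounded_measurableB.
have DM n w : `|D n w| <= M + M by rewrite (le_trans (ler_normB _ _))// lerD.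
have DD_cvg0 m : \int[P]_w (D m w * D n w) @[n --> \oo] --> (0 : R).
  apply: (@int_mul_cvg0 _ _ _ P (limit_sigma G) D (M + M)) => //.
  - by move=> n; have [] := bD n.
  - exact: limit_sigma_int_cvg0.
  - apply: bounded_measurableB; first by split => //; exists M.
    split; last by exists M.
    have Gmoo : G m `<=` limit_sigma G.
      by move=> B GB; apply: sub_sigma_algebra; exists m.
    exact: (measurable_fun_sub_sigma (sG m) sGoo Gmoo (@mb m)).
apply/cvgr0Pnorm_le => e e0.
(* [M + M] bounds [D n], and the increments of [a] and [b] each cost this much, so the second term
   stays below [e / 2]. *)
have eM : 0 < e / 4 / (M + M + 1) by rewrite !divr_gt0// ltr_wpDl// addr_ge0.
have [N1 N1P] := ca _ eM; have [N2 N2P] := cb _ eM.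
pose m := maxn N1 N2.
have e20 : 0 < e / 2 by rewrite divr_gt0.
have /cvgr0Pnorm_le/(_ _ e20)[N3 _ N3P] := DD_cvg0 m.
exists (maxn m N3) => // n /=; rewrite geq_max => /andP[mn N3n].
have bDD k j : bounded_measurable (fun w => D k w - D j w).
  exact: bounded_measurableB.
have -> : \int[P]_w (D n w ^+ 2) = \int[P]_w (D m w * D n w) +
    \int[P]_w ((D n w - D m w) * D n w).
  rewrite -bRintegralD; [|exact: bounded_measurableM..].
  by apply: eq_Rintegral => w _; ring.
rewrite (le_trans (ler_normD _ _))// (splitr e) lerD//; first exact: N3P.
have bDDD : bounded_measurable (fun w => (D n w - D m w) * D n w).
  exact: bounded_measurableM.
rewrite (le_trans (norm_bRintegral P bDDD))//.
apply: (@le_trans _ _ (\int[P]_w ((M + M) * (`|a n w - a m w| + `|b n w - b m w|)))).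
  have babs := bounded_measurableD (bounded_measurable_dist (ba n) (ba m))
                (bounded_measurable_dist (bb n) (bb m)).
  apply: le_bRintegral.
  - exact: bounded_measurable_norm.
  - exact: bounded_measurableM (bounded_measurable_cst _) babs.
  - move=> w; rewrite normrM mulrC ler_pM//.
    rewrite (_ : _ - _ = (a n w - a m w) - (b n w - b m w)); last by rewrite /D; ring.
    exact: ler_normB.
rewrite bRintegralZl; last by apply: bounded_measurableD; exact: bounded_measurable_dist.
rewrite bRintegralD; [|exact: bounded_measurable_dist..].
have N1n : (N1 <= n)%N by rewrite (leq_trans _ mn)// leq_maxl.
have N2n : (N2 <= n)%N by rewrite (leq_trans _ mn)// leq_maxr.
have MM0 : 0 <= M + M by rewrite addr_ge0.
apply: (le_trans (ler_wpM2l MM0 (lerD (N1P n m N1n (leq_maxl _ _))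
  (N2P n m N2n (leq_maxr _ _))))).
rewrite -subr_ge0 (_ : _ - _ = e / 2 / (M + M + 1)).
  by rewrite !divr_ge0 ?ltW// ltr_wpDl.
by field; rewrite gt_eqF// ltr_wpDl.
Qed.

End martingale.

(** * Passing from the chosen versions to almost surely equal bounded ones *)

Section versions.
Context {R : realType} {d : measure_display} {Omega : measurableType d}.
Variable P : probability Omega R.

Lemma expectation_sqr_version (Y Z : Omega -> R) : measurable_fun setT Y ->
  bounded_measurable Z -> Y = Z %[ae P] ->
  'E_P[fun w => (Y w ^+ 2)%R]%E = (\int[P]_w (Z w ^+ 2))%:E.
Proof.
move=> mY bZ YZ; rewrite EFin_bRintegral; last exact: bounded_measurableX.
rewrite unlock; apply: ae_eq_integral => //.
- by apply/measurable_EFinP; exact: measurable_funX.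
- by apply/measurable_EFinP; apply: measurable_funX; have [] := bZ.
- by apply: filterS YZ => w /= /[apply] ->.
Qed.

Lemma probability_dist_gt_version (Y Z V : Omega -> R) (e : R) :
  measurable_fun setT Y -> measurable_fun setT Z -> measurable_fun setT V ->
  Y = Z %[ae P] ->
  P [set w | e < `|Y w - V w|] = P [set w | e < `|Z w - V w|].
Proof.
move=> mY mZ mV YZ.
have mYV := measurable_dist_gt e mY mV; have mZV := measurable_dist_gt e mZ mV.
rewrite -[LHS]fineK ?fin_num_measure// -[RHS]fineK ?fin_num_measure//.
rewrite -!Rintegral_indic//; congr EFin; apply: Rintegral_ae_eq.
- exact: measurable_indic.
- exact: measurable_indic.
- by apply: filterS YZ => w /= /[apply] YZw; rewrite !indicE /in_mem/= /in_set/= YZw.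
Qed.

End versions.

(** * The natural filtration consists of sub-sigma-fields *)

Section natural_filtration.
Context {R : realType} {d d' : measure_display}.
Context {Omega : measurableType d} {S : measurableType d'}.
Context {P : probability Omega R}.
Variable X : nat -> {RV P >-> S}.

Lemma natural_filtration_sigma_algebra n :
  sigma_algebra setT (natural_filtration X n).
Proof. exact: smallest_sigma_algebra. Qed.

Lemma natural_filtration_measurable n : natural_filtration X n `<=` measurable.
Proof.
apply: smallest_sub; first exact: sigma_algebra_measurable.
(* The generator is a finite union over the coordinates, empty for [n = 0]. *)
apply: (big_ind (fun C : set (set Omega) => C `<=` measurable)) => //.
  by move=> A B Am Bm; rewrite subUset.
by move=> i _ _ [B mB <-]; exact: measurable_funP.
Qed.

End natural_filtration.

(** * The two implications, proved for one function at a time *)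

Theorem theorem9 (R : realType) (d d' : measure_display)
    (Omega : measurableType d) (S : measurableType d') (P : probability Omega R)
    (X : nat -> {RV P >-> S}) (G : nat -> set (set Omega)) :
  standard_borel R S ->
  filtration G ->
  (forall n, G n `<=` natural_filtration X n) ->
  (forall (n k : nat) (f : S -> R), (n < k)%N -> bounded_measurable f ->
     cond_exp P (G n) (f \o X k) = cond_exp P (G n) (f \o X n.+1) %[ae P]) ->
  let a := forall f : S -> R, bounded_measurable f ->
    cvg_in_probability P (fun n => alpha X n f) in
  let b := forall f : S -> R, bounded_measurable f ->
    exists l : R,
      'E_P[fun w => (alpha X n f w ^+ 2)%R]%E @[n --> \oo] --> l%:E /\
      'E_P[fun w => (beta X G n f w ^+ 2)%R]%E @[n --> \oo] --> l%:E in
  (b -> a) /\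
  (limit_sigma G = limit_sigma (natural_filtration X) -> a -> b).
Proof.
move=> _ filG GF GX a b; have [sG Gm G_nd] := filG.
pose F := natural_filtration X.
have sF n : sigma_algebra setT (F n) by exact: natural_filtration_sigma_algebra.
have Fm n : F n `<=` measurable by exact: natural_filtration_measurable.
(* Each implication holds separately for every [f], so [f] can be fixed. *)
suff key (f : S -> R) : bounded_measurable f ->
  [/\ (exists l : R,
      'E_P[fun w => (alpha X n f w ^+ 2)%R]%E @[n --> \oo] --> l%:E /\
      'E_P[fun w => (beta X G n f w ^+ 2)%R]%E @[n --> \oo] --> l%:E) ->
      cvg_in_probability P (fun n => alpha X n f) &
      limit_sigma G = limit_sigma F ->
      cvg_in_probability P (fun n => alpha X n f) ->
      exists l : R,
      'E_P[fun w => (alpha X n f w ^+ 2)%R]%E @[n --> \oo] --> l%:E /\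
      'E_P[fun w => (beta X G n f w ^+ 2)%R]%E @[n --> \oo] --> l%:E].
  by split=> [hb f bf|GFoo ha f bf]; have [ba ab] := key f bf;
    [exact/ba/hb|exact/ab/ha].
move=> bf; have [mf [M fM]] := bf.
pose Y n : Omega -> R := f \o X n.+1.
have mY n : measurable_fun setT (Y n) by exact: measurableT_comp.
have YM n w : `|Y n w| <= M by exact: fM.
have bY n : bounded_measurable (Y n) by split => //; exists M.
have iY n := bounded_measurable_integrable P (bY n).
(* From here on [u n] and [v n] stand for [alpha X n f] and [beta X G n f], with the bound [M] at
   every point. *)
have /choice[u uP] n := bounded_cond_exp P (sF n) (Fm n) (mY n) (YM n).
have /choice[v vP] n := bounded_cond_exp P (sG n) (Gm n) (mY n) (YM n).
have malpha n : measurable_fun setT (alpha X n f).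
  have [mZ _ _] := cond_expP (sF n) (Fm n) (iY n).
  exact: measurable_fun_of_sigma mZ.
have mbeta n : measurable_fun setT (beta X G n f).
  have [mZ _ _] := cond_expP (sG n) (Gm n) (iY n).
  exact: measurable_fun_of_sigma mZ.
have muF n : measurable_fun (setT : set (g_sigma_algebraType (F n))) (u n).
  by have [] := uP n.
have mu n : measurable_fun setT (u n).
  exact: (measurable_fun_of_sigma (sF n) (Fm n) (@muF n)).
have uM n w : `|u n w| <= M by have [_ + _ _] := uP n.
have bu n : bounded_measurable (u n) by split => //; exists M.
have mvG n : measurable_fun (setT : set (g_sigma_algebraType (G n))) (v n).
  by have [] := vP n.
have mv n : measurable_fun setT (v n).
  exact: (measurable_fun_of_sigma (sG n) (@Gm n) (@mvG n)).
have vM n w : `|v n w| <= M by have [_ + _ _] := vP n.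
have bv n : bounded_measurable (v n) by split => //; exists M.
have uE n : alpha X n f = u n %[ae P] by have [] := uP n.
have vE n : beta X G n f = v n %[ae P] by have [] := vP n.
(* Tower property: a set of [G n] is also in [F n], so both sides equal the integral of [Y n] over
   it. *)
have uv n A : G n A -> \int[P]_w (\1_A w * u n w) = \int[P]_w (\1_A w * v n w).
  move=> GA; have [_ _ _ ->] := uP n; last exact: GF.
  by have [_ _ _ ->] := vP n.
(* On sets of [G m], [v n] and [v m] integrate like [Y n] and [Y m]. These have the same conditional
   expectation given [G m] by [GX] with [k = n.+1]; the required [m < n.+1] is [m <= n]. *)
have v_martingale m n A : (m <= n)%N -> G m A ->
    \int[P]_w (\1_A w * v n w) = \int[P]_w (\1_A w * v m w).
  move=> mn GA; have [_ _ _ ->] := vP n; last exact: G_nd GA.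
  have [_ _ _ ->] := vP m => //.
  have [mZn _ /(_ _ GA) ZnE] := cond_expP (sG m) (Gm m) (iY n).
  have [mZm _ /(_ _ GA) ZmE] := cond_expP (sG m) (Gm m) (iY m).
  have mA := Gm _ _ GA.
  rewrite -!Rintegral_indicE /Rintegral -ZnE -ZmE; congr fine.
  apply: ae_eq_integral => //.
  - apply/measurable_EFinP/measurable_funTS.
    exact: (measurable_fun_of_sigma (sG m) (@Gm m) mZn).
  - apply/measurable_EFinP/measurable_funTS.
    exact: (measurable_fun_of_sigma (sG m) (@Gm m) mZm).
  - have := GX m n.+1 f mn bf.
    by apply: filterS => w /= /(_ Logic.I) ->.
have EalphaE : (fun n => 'E_P[fun w => (alpha X n f w ^+ 2)%R]%E) =
    fun n => (\int[P]_w (u n w ^+ 2))%:E.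
  by apply/funext => n; exact: expectation_sqr_version.
have EbetaE : (fun n => 'E_P[fun w => (beta X G n f w ^+ 2)%R]%E) =
    fun n => (\int[P]_w (v n w ^+ 2))%:E.
  by apply/funext => n; exact: expectation_sqr_version.
rewrite {}EalphaE {}EbetaE.
have uv_decomp := projection_sqr_dist filG mvG vM mu uM uv.
have cv := martingale_L1_cauchy filG mvG vM v_martingale.
split.
- move=> [l [/fine_cvg ul /fine_cvg vl]].
  (* By Pythagoras this is the difference of two second moments with the same limit [l]. *)
  have uv0 : \int[P]_w ((u n w - v n w) ^+ 2) @[n --> \oo] --> (0 : R).
    rewrite -(subrr l) (_ : (fun n => _) = fun n =>
      \int[P]_w (u n w ^+ 2) - \int[P]_w (v n w ^+ 2)); first exact: cvgB.
    by apply/funext => n; rewrite uv_decomp addrC addKr.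
  have [Z [bZ vZ]] := L1_cauchy_cvg mv vM cv.
  have [mZ _] := bZ.
  pose Z' : {RV P >-> R} := HB.pack Z (isMeasurableFun.Build _ _ _ _ _ mZ).
  exists Z' => e e0.
  under eq_cvg do rewrite (probability_dist_gt_version e (malpha _) (mu _) mZ (uE _)).
  apply: L1_cvg_in_probability => //.
  apply/cvgr0Pnorm_le => r r0.
  have r4 : 0 < r / 4 by rewrite divr_gt0.
  (* At scale [r / 4], this bound on the second moment keeps the L1 distance of [u n] and [v n]
     below [r / 2]; the distance from [v n] to [Z] adds at most [r / 4]. *)
  have r2 : 0 < r ^+ 2 / 16 by rewrite divr_gt0// exprn_gt0.
  have /cvgr0Pnorm_le/(_ _ r4) := vZ; have /cvgr0Pnorm_le/(_ _ r2) := uv0.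
  apply: filterS2 => n uvn vZn.
  rewrite ger0_norm ?Rintegral_ge0//.
  apply: (le_trans (Rintegral_dist_triangle P (bu n) (bv n) bZ)).
  have := Rintegral_norm_le_sqr P r4 (bounded_measurableB (bu n) (bv n)).
  have r4V : 0 <= (r / 4)^-1 by rewrite invr_ge0 ltW.
  have := ler_wpM2l r4V (le_trans (ler_norm _) uvn).
  have := le_trans (ler_norm _) vZn.
  rewrite (_ : (r / 4)^-1 * (r ^+ 2 / 16) = r / 4); last by field; exact: lt0r_neq0.
  lra.
- move=> GFoo [Z uZ].
  have mZ : measurable_fun setT Z by exact: measurable_funP.
  have cu : L1_cauchy P u.
    apply: (cvg_in_probability_L1_cauchy mu uM mZ) => e e0.
    have := uZ e e0; under eq_cvg do
      rewrite (probability_dist_gt_version e (malpha _) (mu _) mZ (uE _)).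
    by [].
  (* Here the equality of the two limit sigma-fields enters: it makes [u n] measurable for
     [limit_sigma G]. *)
  have muG n : measurable_fun
      (setT : set (g_sigma_algebraType (limit_sigma G))) (u n).
    have sFoo : sigma_algebra setT (limit_sigma F).
      exact: smallest_sigma_algebra.
    have FFoo : F n `<=` limit_sigma F.
      by move=> A FA; apply: sub_sigma_algebra; exists n.
    by rewrite GFoo; exact: (measurable_fun_sub_sigma (sF n) sFoo FFoo (@muF n)).
  have uv0 := projection_dist_cvg0 filG mvG vM mu uM uv cu cv muG.
  have vl := martingale_sqr_cvg filG mvG vM v_martingale.
  (* The second moments of [u n] exceed those of [v n] by a term that tends to 0, so both share this
     limit. *)
  exists (limn (fun n => \int[P]_w (v n w ^+ 2))).
  split; apply: cvg_EFin; try exact: nearW; last exact: vl.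
  rewrite -[limn _]addr0 /=.
  under eq_cvg do rewrite /= uv_decomp.
  exact: cvgD.
Qed.
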